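(* For all integers $n\ge 0$ and $t\ge 0$, the following hold. (i) $B_5^{(20t+1)}(20n+14)\equiv 0\pmod{10}$. (ii) $B_5^{(20t+9)}(20n+\alpha)\equiv 0\pmod{10}$ for every $\alpha\in\{14,18\}$. (iii) $B_5^{(20t+17)}(20n+\alpha)\equiv 0\pmod{10}$ for every $\alpha\in\{2,14,18\}$.
   Context: For positive integers $\ell,r$ and an integer $n\ge 0$, $B_\ell^{(r)}(n)$ denotes the number of $\ell$-regular $r$-multipartitions of $n$, i.e. ordered $r$-tuples $(\lambda^{(1)},\dots,\lambda^{(r)})$ of (possibly empty) integer partitions, each having no part divisible by $\ell$, whose sizes sum to $n$; $B_\ell^{(r)}(0)=1$. Equivalently, as formal power series, $$\sum_{n=0}^\infty B_\ell^{(r)}(n)q^n=\frac{E_\ell^r}{E_1^r},\qquad E_k:=\prod_{m=1}^\infty(1-q^{km}).$$ *)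

(* Defs.v *)
From mathcomp Require Import all_boot.

Set Implicit Arguments.
Unset Strict Implicit.
Unset Printing Implicit Defensive.

Definition is_partition (s : seq nat) : bool := sorted geq s && (0 \notin s).

Definition regular (l : nat) (s : seq nat) : bool :=
  all (fun k => ~~ (l %| k)) s.

Definition regular_multipartition (l r n : nat) (t : r.-tuple (seq nat)) : bool :=
  [forall i, is_partition (tnth t i) && regular l (tnth t i)]
  && (\sum_(i < r) sumn (tnth t i) == n).

(* The seq nat components of a multipartition of n have at most n parts, each
   at most n, so it suffices to count in the finite type of r-tuples of
   sequences of length at most n over {0, ..., n}; see B_unique_count. *)
Definition unbound (r n : nat) (u : r.-tuple (n.-bseq 'I_n.+1)) :
    r.-tuple (seq nat) :=
  map_tuple (fun s : n.-bseq 'I_n.+1 => map val s) u.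

Definition B (l r n : nat) : nat :=
  #|[set u : r.-tuple (n.-bseq 'I_n.+1) | regular_multipartition l n (unbound u)]|.

Lemma unbound_inj (r n : nat) : injective (@unbound r n).
Proof.
move=> u v /(congr1 val) /= /inj_map uv; apply/val_inj/uv => s1 s2 s12.
by apply/val_inj; apply: (inj_map val_inj) s12.
Qed.

Lemma size_le_sumn (s : seq nat) : 0 \notin s -> size s <= sumn s.
Proof.
elim: s => //= k s IHs; rewrite inE negb_or => /andP[k0 /IHs le_s].
by rewrite -add1n leq_add // lt0n eq_sym.
Qed.

Lemma mem_le_sumn (s : seq nat) (k : nat) : k \in s -> k <= sumn s.
Proof.
elim: s => //= m s IHs; rewrite inE => /orP[/eqP->|/IHs le_k].
  exact: leq_addr.
exact: leq_trans le_k (leq_addl _ _).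
Qed.

Lemma unbound_surj (l r n : nat) (t : r.-tuple (seq nat)) :
  regular_multipartition l n t -> exists u : r.-tuple (n.-bseq 'I_n.+1), unbound u = t.
Proof.
case/andP=> /forallP t_part /eqP t_sum.
have le_n i : sumn (tnth t i) <= n.
  by rewrite -t_sum (bigD1 i) //= leq_addr.
have size_n i : size (map (@inord n) (tnth t i)) <= n.
  have /andP[/andP[_ t0] _] := t_part i.
  by rewrite size_map (leq_trans (size_le_sumn t0)).
exists [tuple Bseq (size_n i) | i < r].
apply: eq_from_tnth => i; rewrite tnth_map tnth_mktuple /= -map_comp.
rewrite -[RHS]map_id; apply/eq_in_map => k kt /=.
by rewrite inordK // ltnS (leq_trans (mem_le_sumn kt)).
Qed.

Lemma B_unique_count (l r n : nat) (S : seq (r.-tuple (seq nat))) :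
  uniq S -> (forall t, (t \in S) = regular_multipartition l n t) ->
  B l r n = size S.
Proof.
move=> uniqS memS; rewrite /B cardE -(size_map (@unbound r n)).
apply/perm_size/uniq_perm => //.
  by rewrite map_inj_uniq ?enum_uniq //; apply: unbound_inj.
move=> t; rewrite memS; apply/mapP/idP => [[u]|t_mp].
  by rewrite mem_enum inE => u_mp ->.
have [u ut] := unbound_surj t_mp.
by exists u; rewrite // mem_enum inE ut.
Qed.

(* Main.v *)
Require Import Defs.
From mathcomp Require Import all_boot order all_algebra zify ring.

(* Let G be the generating function of B_5^(1), so that G^r generates B_5^(r).

   Modulo 5, E_5 = E_1^5, hence G^r = E_1^(4r); for r = 1, 9, 17 mod 20 this is a
   series in q^5 times E_1^4, E_1, E_1^3 respectively.  Euler's pentagonal number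
   theorem and Jacobi's formula for E_1^3 confine the exponents mod 5 of these
   three factors to {0,1,2,3}, {0,1,2} and {0,1}.

   Modulo 2, for r = 4m + 1, multiplying G^r by the series E_1^(4m+4) in q^4 gives
   E_5^(4m) E_5 E_1^3, so it suffices that the coefficient of E_5 E_1^3 at 4k + 2 is
   even.  By Euler and Jacobi it counts the positive solutions of
   3x^2 + 5y^2 = 8(12k + 7) with x odd and y prime to 6, on which a unit of norm 1
   in Q(sqrt(-15)) induces an involution; a fixed point would make 12k + 7 a square.

   Power series are represented by polynomials modulo a power of 'X. *)

Import GRing.Theory.

Set Implicit Arguments.
Unset Strict Implicit.
Unset Printing Implicit Defensive.

(** * Polynomials modulo a power of 'X *)

Section Congruence.
Local Open Scope ring_scope.
Variable F : fieldType.
Implicit Types (f g h u : {poly F}) (K : nat).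

Definition eqmodX K f g := 'X^K %| f - g.

Lemma eqmodX_coef K f g i : eqmodX K f g -> (i < K)%N -> f`_i = g`_i.
Proof.
move=> /dvdpP[h fg] iK; apply/eqP.
by rewrite -subr_eq0 -coefB fg coefMXn iK.
Qed.

Lemma coef_eqmodX K f g :
  (forall i, (i < K)%N -> f`_i = g`_i) -> eqmodX K f g.
Proof.
move=> fg; rewrite /eqmodX -(poly_take_drop K (f - g)).
rewrite (_ : take_poly _ _ = 0) ?add0r ?dvdp_mull //.
apply/polyP=> i; rewrite coef_take_poly coef0 coefB.
by case: ifP => // /fg ->; rewrite subrr.
Qed.

Lemma eqmodX_refl K f : eqmodX K f f.
Proof. by rewrite /eqmodX subrr dvdp0. Qed.

Lemma eqmodX_sym K f g : eqmodX K f g -> eqmodX K g f.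
Proof. by rewrite /eqmodX -dvdpNr opprB. Qed.

Lemma eqmodX_trans K g f h : eqmodX K f g -> eqmodX K g h -> eqmodX K f h.
Proof. by rewrite /eqmodX => fg gh; rewrite -(subrK g f) -addrA dvdp_add. Qed.

Lemma eqmodXD K f g f' g' :
  eqmodX K f g -> eqmodX K f' g' -> eqmodX K (f + f') (g + g').
Proof. by rewrite /eqmodX => fg fg'; rewrite opprD addrACA dvdp_add. Qed.

Lemma eqmodXM K f g f' g' :
  eqmodX K f g -> eqmodX K f' g' -> eqmodX K (f * f') (g * g').
Proof.
move=> fg fg'; rewrite /eqmodX (_ : _ - _ = (f - g) * f' + g * (f' - g')); last by ring.
by apply: dvdp_add; [apply: dvdp_mulr | apply: dvdp_mull].
Qed.

Lemma eqmodXX K f g n : eqmodX K f g -> eqmodX K (f ^+ n) (g ^+ n).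
Proof.
move=> fg; elim: n => [|n IHn]; first exact: eqmodX_refl.
by rewrite !exprS; apply: eqmodXM.
Qed.

Lemma eqmodX_sum K n (f g : nat -> {poly F}) :
  (forall i, (i < n)%N -> eqmodX K (f i) (g i)) ->
  eqmodX K (\sum_(i < n) f i) (\sum_(i < n) g i).
Proof.
move=> fg; apply: (big_ind2 (eqmodX K)) => [|f1 g1 f2 g2|i _].
- exact: eqmodX_refl.
- exact: eqmodXD.
- exact: fg.
Qed.

Lemma eqmodX_leq K K' f g : (K' <= K)%N -> eqmodX K f g -> eqmodX K' f g.
Proof. by move=> le; apply/dvdp_trans/dvdp_exp2l. Qed.

Lemma eqmodXXnM K n f g : eqmodX K f g -> eqmodX (n + K) ('X^n * f) ('X^n * g).
Proof. by move=> fg; rewrite /eqmodX -mulrBr exprD dvdp_mul. Qed.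

(** A factor with non-zero constant term is prime to ['X], hence a unit modulo every power of it. *)
Lemma eqmodX_cancel K u f g :
  u`_0 != 0 -> eqmodX K (f * u) (g * u) -> eqmodX K f g.
Proof.
move=> u0; rewrite /eqmodX -mulrBl Gauss_dvdpl // coprimep_expl //.
by rewrite coprimep_sym coprimepX /root horner_coef0.
Qed.

Lemma eqmodX_comp K n f g :
  eqmodX K f g -> eqmodX (n * K) (f \Po 'X^n) (g \Po 'X^n).
Proof.
move=> /dvdpP[h fg]; rewrite /eqmodX -comp_polyB fg comp_polyM comp_Xn_poly.
by rewrite -exprM dvdp_mull.
Qed.

End Congruence.

(** * The theorems of Euler and Jacobi *)

Section EulerProduct.
Local Open Scope ring_scope.
Variable F : fieldType.

(** The q-Pochhammer symbol (q; q)_n with q = ['X]; by [qpoch_leq] it stands for E_1 modulo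
    ['X^(n.+1)]. *)
Definition qpoch n : {poly F} := \prod_(1 <= i < n.+1) (1 - 'X^i).

Lemma qpochS n : qpoch n.+1 = qpoch n * (1 - 'X^(n.+1)).
Proof. by rewrite /qpoch big_nat_recr. Qed.

Lemma qpoch0 : qpoch 0 = 1.
Proof. by rewrite /qpoch big_geq. Qed.

Lemma qpoch_coef0 n : (qpoch n)`_0 = 1.
Proof.
elim: n => [|n IHn]; first by rewrite qpoch0 coefC.
by rewrite qpochS coef0M IHn mul1r coefB coef1 coefXn subr0.
Qed.

Lemma qpoch_neq0 n : qpoch n != 0.
Proof.
apply/eqP=> /(congr1 (fun f : {poly F} => f`_0))/eqP.
by rewrite qpoch_coef0 coef0 oner_eq0.
Qed.

Lemma qpoch_leq m n : (m <= n)%N -> eqmodX m.+1 (qpoch n) (qpoch m).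
Proof.
elim: n => [|n IHn]; first by rewrite leqn0 => /eqP ->; apply: eqmodX_refl.
rewrite leq_eqVlt => /predU1P[->|le]; first exact: eqmodX_refl.
apply: eqmodX_trans (IHn le); rewrite qpochS /eqmodX.
by rewrite mulrBr mulr1 addrAC subrr add0r dvdpNr dvdp_mull // dvdp_exp2l.
Qed.

(* Shanks' truncation of the pentagonal number theorem: the k = 0 term is [qpoch n],
   all others have order greater than n. *)
Definition shanks n : {poly F} :=
  \sum_(0 <= k < n.+1) (-1) ^+ k * \prod_(k.+1 <= i < n.+1) (1 - 'X^i)
     * 'X^(n * k + 'C(k.+1, 2)).

(** With N = n + 1 the new exponents are the pentagonal numbers N(3N - 1)/2 and N(3N + 1)/2. *)
Lemma shanksS n :
  shanks n.+1 = shanks n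
    + (-1) ^+ n.+1 * ('X^(n.+1 * n.+1 + 'C(n.+1, 2)) + 'X^(n.+1 * n.+1 + 'C(n.+2, 2))).
Proof.
rewrite {1}/shanks big_nat_recr //= (big_geq (leqnn n.+2)).
(* The k-th terms for n + 1 and n differ by [A (k - 1) - A k], so the sum telescopes. *)
pose A k : {poly F} := (-1) ^+ k * \prod_(k.+1 <= i < n.+1) (1 - 'X^i)
     * 'X^(n.+1 * k.+1 + 'C(k.+1, 2)).
suff -> : \sum_(0 <= k < n.+1) (-1) ^+ k * \prod_(k.+1 <= i < n.+2) (1 - 'X^i)
     * 'X^(n.+1 * k + 'C(k.+1, 2)) = shanks n - A n.
  by rewrite /A (big_geq (leqnn n.+1)) (exprS (-1)); ring.
rewrite /shanks; have : forall m, (m <= n)%N ->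
  \sum_(0 <= k < m.+1) (-1) ^+ k * \prod_(k.+1 <= i < n.+2) (1 - 'X^i)
     * 'X^(n.+1 * k + 'C(k.+1, 2))
  = \sum_(0 <= k < m.+1) (-1) ^+ k * \prod_(k.+1 <= i < n.+1) (1 - 'X^i)
     * 'X^(n * k + 'C(k.+1, 2)) - A m; last by apply.
elim=> [|m IHm] mn.
  rewrite !big_nat1 /A big_nat_recr //= !muln0 !muln1 bin_small //= !addn0.
  by rewrite !expr0; ring.
rewrite big_nat_recr //= IHm 1?ltnW // [in RHS]big_nat_recr //= /A.
rewrite (big_nat_recr n.+1) //= (big_ltn (mn : m.+1 < n.+1)%N).
set P := \prod_(_ <= i < _) _; set S := \sum_(_ <= i < _) _.
(* All powers are written through one common power, ['X^(m.+1)] and ['X^(n.+1)], which leaves an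
   identity for [ring]. *)
have -> : 'X^(n.+1 * m.+1 + 'C(m.+1, 2)) = 'X^(n * m.+1 + 'C(m.+2, 2)) :> {poly F}.
  by congr ('X^_); rewrite [in RHS]binS bin1; lia.
have -> : 'X^(n.+1 * m.+1 + 'C(m.+2, 2)) = 'X^(n * m.+1 + 'C(m.+2, 2)) * 'X^(m.+1) :> {poly F}.
  by rewrite -exprD; congr ('X^_); lia.
have -> : 'X^(n.+1 * m.+2 + 'C(m.+2, 2))
    = 'X^(n * m.+1 + 'C(m.+2, 2)) * 'X^(m.+1) * 'X^(n.+1) :> {poly F}.
  by rewrite -!exprD; congr ('X^_); lia.
by rewrite (exprS (-1)); ring.
Qed.

Lemma qpoch_shanks n : eqmodX n.+1 (qpoch n) (shanks n).
Proof.
rewrite /shanks big_ltn // -/(qpoch n) expr0 mul1r muln0 bin_small // mulr1 /eqmodX.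
rewrite opprD addrA subrr add0r dvdpNr big_nat.
apply: (big_ind (fun f => 'X^(n.+1) %| f)); [exact: dvdp0 | exact: dvdp_add |].
move=> k /andP[k0 _]; apply/dvdp_mull/dvdp_exp2l.
by rewrite binS bin1; nia.
Qed.

(** * Gaussian binomial coefficients in q = ['X], from the q-Pascal rule *)

Fixpoint gbin m k : {poly F} :=
  match m, k with
  | _, 0 => 1
  | 0, _.+1 => 0
  | m'.+1, k'.+1 => gbin m' k' + 'X^(k) * gbin m' k
  end.

Lemma gbinS m k : gbin m.+1 k.+1 = gbin m k + 'X^(k.+1) * gbin m k.+1.
Proof. by []. Qed.

Lemma gbin0 m : gbin m 0 = 1.
Proof. by case: m. Qed.

Lemma gbin_small m k : (m < k)%N -> gbin m k = 0.
Proof.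
elim: m k => [|m IHm] [|k] // mk.
by rewrite gbinS !IHm ?mulr0 ?addr0 // ltnW.
Qed.

Lemma gbin_qpoch a b : gbin (a + b) a * qpoch a * qpoch b = qpoch (a + b).
Proof.
elim: a b => [|a IHa] b; first by rewrite gbin0 qpoch0 !mul1r.
elim: b => [|b IHb].
  rewrite addn0 gbinS (gbin_small (leqnn _)) mulr0 addr0 qpoch0 mulr1 !qpochS mulrA.
  by have := IHa 0%N; rewrite addn0 qpoch0 mulr1 => ->.
rewrite addSn gbinS -addSnnS (qpochS a) (qpochS b) (qpochS (a.+1 + b)).
have := IHa b.+1; rewrite -addSnnS (qpochS b); move: IHb; rewrite (qpochS a).
set G := gbin _ a; set G' := gbin _ a.+1 => IHb IHa'.
have -> : 'X^((a.+1 + b).+1) = 'X^(a.+1) * 'X^(b.+1) :> {poly F}.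
  by rewrite -exprD; congr ('X^_); lia.
(* This split of 1 - q^(a + b + 2) matches the two terms of the q-Pascal rule. *)
have -> : 1 - 'X^(a.+1) * 'X^(b.+1)
    = (1 - 'X^(a.+1)) + 'X^(a.+1) * (1 - 'X^(b.+1)) :> {poly F} by ring.
by rewrite [RHS]mulrDr -{1}IHa' -IHb; ring.
Qed.

Lemma gbin_sym a b : gbin (a + b) a = gbin (a + b) b.
Proof.
apply: (mulIf (qpoch_neq0 a)); apply: (mulIf (qpoch_neq0 b)).
by rewrite gbin_qpoch mulrAC addnC gbin_qpoch.
Qed.

(** The second q-Pascal rule: the first one read through the symmetry k -> m - k. *)
Lemma gbinS_sym m k : gbin m.+1 k.+1 = 'X^(m - k) * gbin m k + gbin m k.+1.
Proof.
have [mk|km] := ltnP m k; first by rewrite !gbin_small ?mulr0 ?addr0 // ltnW.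
rewrite -(subnKC km) addKn; case: (m - k)%N => [|b].
  by rewrite addn0 gbinS !(gbin_small (leqnn _)) mulr0 expr0 mul1r.
rewrite -addSn gbin_sym addSnnS addnS gbinS addrC; congr (_ + _).
  by rewrite -gbin_sym.
by rewrite -addSnnS gbin_sym.
Qed.

Lemma gbinSS m k :
  gbin m.+2 k.+2 = 'X^(m - k) * gbin m k
    + (1 + 'X^(m.+1)) * gbin m k.+1 + 'X^(k.+2) * gbin m k.+2.
Proof.
rewrite gbinS !gbinS_sym.
(* For m <= k the truncated subtraction would spoil the exponent identity below, but then
   [gbin m k.+1] vanishes. *)
have [mk|km] := ltnP m k.+1.
  by rewrite !(gbin_small mk) (gbin_small (ltnW mk : m < k.+2)%N); ring.
have -> : 'X^(m.+1) = 'X^(k.+2) * 'X^(m - k.+1) :> {poly F}.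
  by rewrite -exprD; congr ('X^_); lia.
by ring.
Qed.

(** The coefficient of z^j, for j >= 0, in the finite triple product of the 1 - z q^i for 1 <= i <=
    n and the 1 - q^i / z for 0 <= i <= n. Passing to n + 1 multiplies it by (1 - z q^(n + 1)) (1 -
    q^(n + 1) / z), whence [gaussS]. *)
Definition gauss n j : {poly F} :=
  (-1) ^+ j * 'X^('C(j.+1, 2)) * gbin n.*2.+1 (n + j).+1.

Lemma gauss_small n j : (n < j)%N -> gauss n j = 0.
Proof. by move=> nj; rewrite /gauss gbin_small ?mulr0 // -addnn; lia. Qed.

(* Extending [gauss n] to negative indices would give [gauss n (- 1) = - gauss n 0]. *)
Lemma gaussS n j :
  gauss n.+1 j = (1 + 'X^(n.+1) ^+ 2) * gauss n j
    - 'X^(n.+1) * (gauss n j.+1 + if j is j'.+1 then gauss n j' else - gauss n 0).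
Proof.
have E k : (gbin n.+1.*2.+1 (n.+1 + k).+1 = 'X^(n.+1 - k) * gbin n.*2.+1 (n + k)
    + (1 + 'X^(n.+1) ^+ 2) * gbin n.*2.+1 (n + k).+1
    + 'X^(n.+1) * 'X^(k.+1) * gbin n.*2.+1 (n + k).+2)%R.
  rewrite doubleS addSn gbinSS -exprD -exprM.
  have -> : (n.*2.+1 - (n + k) = n.+1 - k)%N by lia.
  have -> : (n.*2.+2 = n.+1 * 2)%N by lia.
  by have -> : ((n + k).+2 = n.+1 + k.+1)%N by lia.
have T k : 'X^('C(k.+2, 2)) = 'X^('C(k.+1, 2)) * 'X^(k.+1) :> {poly F}.
  by rewrite binS bin1 exprD.
rewrite /gauss E addnS (exprS (-1)) T.
case: j => [|j].
  rewrite subn0 !addn0.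
  have -> : gbin n.*2.+1 n = gbin n.*2.+1 n.+1.
    by rewrite -addnn -addnS gbin_sym.
  by rewrite bin_small // expr0; ring.
(* The index is now j + 1. For j > n all the Gaussian binomials vanish; for j <= n the subtraction
   in the exponent is exact. *)
have [nj|jn] := ltnP n j.
  by rewrite !(gbin_small (_ : n.*2.+1 < _)%N); [ring | lia..].
have -> : 'X^(n.+1) = 'X^(n.+1 - j.+1) * 'X^(j.+1) :> {poly F}.
  by rewrite -exprD; congr ('X^_); lia.
by rewrite T addnS (exprS (-1) j); ring.
Qed.

(* The z-derivative at z = 1 of the finite Jacobi triple product. *)
Lemma qpoch_sqr n : \sum_(j < n.+1) (2 * j).+1%:R * gauss n j = qpoch n ^+ 2.
Proof.
elim: n => [|n IHn].
  rewrite big_ord_recl big_ord0 qpoch0 /gauss gbinS (gbin_small (leqnn 1)) gbin0 bin_small //=.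
  by rewrite !expr0; ring.
pose g := gauss n; pose g' j := if j is j'.+1 then g j' else - g 0%N.
(* Since (2j - 1) + (2j + 3) = 2(2j + 1), shifting the index both ways doubles the sum up to
   boundary terms; these vanish at m = n + 1. *)
have shift m : \sum_(j < m.+1) (2 * j).+1%:R * (g j.+1 + g' j)
    = 2 * \sum_(j < m.+1) (2 * j).+1%:R * g j
      + (2 * m).+1%:R * g m.+1 - (2 * m).+3%:R * g m.
  elim: m => [|m IHm]; first by rewrite !big_ord_recl !big_ord0 /=; ring.
  by rewrite big_ord_recr IHm [in RHS]big_ord_recr /=; ring.
have Eg : \sum_(j < n.+2) (2 * j).+1%:R * g j = qpoch n ^+ 2.
  by rewrite big_ord_recr /= IHn /g gauss_small // mulr0 addr0.
rewrite (eq_bigr (fun j : 'I_n.+2 => (1 + 'X^(n.+1) ^+ 2) * ((2 * j).+1%:R * g j)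
    - 'X^(n.+1) * ((2 * j).+1%:R * (g j.+1 + g' j)))); last first.
  by move=> j _; rewrite gaussS -/g; case: (val j) => [|j'] /=; rewrite /g'; ring.
(* With N = n + 1, the factor left over is 1 + q^(2N) - 2 q^N = (1 - q^N)^2. *)
rewrite sumrB -!mulr_sumr shift Eg /g !gauss_small // qpochS; ring.
Qed.

(** The Gaussian binomial times [qpoch n] is 1 modulo ['X^((n - j).+1)]; the factor
    ['X^('C(j.+1, 2))] restores the lost precision, as ['C(j.+1, 2)] is at least j. *)
Lemma qpoch_gauss n j : (j <= n)%N ->
  eqmodX n.+1 (qpoch n * gauss n j) ((-1) ^+ j * 'X^('C(j.+1, 2))).
Proof.
move=> jn; rewrite /gauss.
have E : (n.*2.+1 = (n - j) + (n + j).+1)%N by lia.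
have gj : eqmodX (n - j).+1 (gbin n.*2.+1 (n + j).+1 * qpoch n) 1.
  apply: (@eqmodX_cancel _ _ (qpoch (n + j).+1)); first by rewrite qpoch_coef0 oner_eq0.
  have := gbin_qpoch (n - j) (n + j).+1; rewrite gbin_sym -E => Eg.
  apply: (@eqmodX_trans _ _ (gbin n.*2.+1 (n + j).+1 * qpoch (n - j) * qpoch (n + j).+1)).
    apply: eqmodXM (eqmodX_refl _ _); apply: eqmodXM (eqmodX_refl _ _) _.
    by apply: qpoch_leq; lia.
  rewrite Eg mul1r; apply: eqmodX_leq (qpoch_leq _); lia.
rewrite (_ : qpoch n * _ =
  (-1) ^+ j * ('X^('C(j.+1, 2)) * (gbin n.*2.+1 (n + j).+1 * qpoch n))); last by ring.
apply: eqmodXM (eqmodX_refl _ _) _.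
have := eqmodXXnM 'C(j.+1, 2) gj; rewrite mulr1; apply: eqmodX_leq.
rewrite binS bin1; lia.
Qed.

Lemma qpoch_cube n :
  eqmodX n.+1 (qpoch n ^+ 3)
    (\sum_(j < n.+1) (2 * j).+1%:R * ((-1) ^+ j * 'X^('C(j.+1, 2)))).
Proof.
rewrite exprS -qpoch_sqr mulr_sumr.
pose f j := qpoch n * ((2 * j).+1%:R * gauss n j).
pose g j : {poly F} := (2 * j).+1%:R * ((-1) ^+ j * 'X^('C(j.+1, 2))).
apply: (@eqmodX_sum _ _ n.+1 f g) => j jn; rewrite /f /g mulrCA.
by apply: eqmodXM (eqmodX_refl _ _) _; apply: qpoch_gauss.
Qed.

End EulerProduct.

(** * The generating function *)

Lemma uniq_flatten_map (T : eqType) (f : nat -> seq T) s (h : T -> nat) :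
    uniq s -> (forall i, uniq (f i)) -> (forall i x, x \in f i -> h x = i) ->
  uniq (flatten (map f s)).
Proof.
move=> us uf fh; elim: s us => //= i s IHs /andP[nis us].
rewrite cat_uniq uf IHs // andbT; apply/hasPn => x /flatten_mapP[j js xj].
by apply: contra nis => /fh; rewrite (fh j x xj) => <-.
Qed.

(** * Enumeration of regular partitions and multipartitions *)

Section Partitions.
Variable l : nat.

(** The l-regular partitions of n with parts at most m, split by whether m occurs. Matching on
    [n - m'] exhibits n' = n - (m' + 1) as structurally smaller than n. *)
Fixpoint parts (m : nat) : nat -> seq (seq nat) :=
  if m is m'.+1 then
    fix loop n := parts m' n ++
      (if l %| m'.+1 then [::] else
       if n - m' is n'.+1 then [seq m'.+1 :: s | s <- loop n'] else [::])
  else fun n => nseq (n == 0) [::].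

Lemma partsS m n : parts m.+1 n = parts m n ++
  (if (l %| m.+1) || (n <= m) then [::] else
   [seq m.+1 :: s | s <- parts m.+1 (n - m.+1)]).
Proof.
have -> : parts m.+1 n = parts m n ++
    (if l %| m.+1 then [::] else
     if n - m is n'.+1 then [seq m.+1 :: s | s <- parts m.+1 n'] else [::]).
  by case: n.
case: (l %| m.+1) => //=; congr (_ ++ _); case: leqP => nm.
  by rewrite (eqP (nm : n - m == 0)).
by rewrite -(subnSK nm).
Qed.

Lemma parts0 n : parts 0 n = nseq (n == 0) [::].
Proof. by []. Qed.

Arguments parts : simpl never.

Definition part_pred m n s :=
  [&& is_partition s, regular l s, all (geq m) s & sumn s == n].

Lemma mem_parts m n s : (s \in parts m n) = part_pred m n s.
Proof.
rewrite /part_pred /is_partition.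
elim: m n s => [|m IHm] n s.
  rewrite parts0; case: s => [|[|k] s] /=; last 2 first.
  - by rewrite andbF mem_nseq /= andbF.
  - by rewrite mem_nseq !andbF.
  by rewrite mem_nseq eqxx andbT eq_sym; case: eqP.
elim/ltn_ind: n s => n IHn s; rewrite partsS mem_cat IHm.
have cons_mem t : (m.+1 :: t \in
    if (l %| m.+1) || (n <= m) then [::] else [seq m.+1 :: s | s <- parts m.+1 (n - m.+1)])
  = [&& ~~ (l %| m.+1), m < n & t \in parts m.+1 (n - m.+1)].
  case: (l %| m.+1) => //=; case: leqP => //= _.
  by rewrite mem_map // => ? ? [].
(* In a decreasing sequence with parts at most m + 1, the part m + 1 occurs only if it is the
   head. *)
have [[t ->]|nt] : (exists t, s = m.+1 :: t) \/
    ((forall t, s <> m.+1 :: t) /\ (sorted geq s -> all (geq m.+1) s = all (geq m) s)).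
  case: s => [|k t]; [by right; split|].
  have [->|km] := eqVneq k m.+1; first by left; exists t.
  right; split => [t' [/eqP]|]; first by rewrite (negPf km).
  rewrite /= path_sortedE; last by move=> ? ? ? /= ba cb; apply: leq_trans cb ba.
  case/andP=> tk _; have -> : (k <= m.+1) = (k <= m) by rewrite leq_eqVlt (negPf km).
  case: leqP => //= le_km; rewrite !(introT allP) // => x /(allP tk) /= ?; lia.
- rewrite cons_mem /= ltnn !andbF /=.
  have [mn|nm] := leqP m.+1 n; last first.
    by rewrite andbF; apply/esym/negbTE; rewrite !negb_and; apply/or4P/Or44; lia.
  rewrite IHn; last by lia.
  rewrite path_sortedE; last by move=> ? ? ? /= ba cb; apply: leq_trans cb ba.
  rewrite inE /= leqnn /=.
  have -> : (m.+1 + sumn t == n) = (sumn t == n - m.+1) by lia.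
  case: (l %| _); rewrite ?andbF //=.
  by case: (all _ _); rewrite ?andbF ?andbT.
- case: nt => nt allE.
  have -> : s \in (if (l %| m.+1) || (n <= m) then [::] else
      [seq m.+1 :: s | s <- parts m.+1 (n - m.+1)]) = false.
    by case: ifP => // _; apply/negP => /mapP[t _ st]; case: (nt t).
  rewrite orbF; case: (boolP (sorted geq s)) => //= /allE ->.
  by [].
Qed.

Lemma uniq_parts m n : uniq (parts m n).
Proof.
elim: m n => [|m IHm] n; first by rewrite parts0; case: (n == 0).
elim/ltn_ind: n => n IHn; rewrite partsS cat_uniq IHm /=.
case: ifP => //= /norP[_ nm]; rewrite map_inj_uniq; last by move=> ? ? [].
rewrite IHn ?andbT; last by lia.
apply/hasPn => _ /mapP[t _ ->]; rewrite mem_parts /part_pred /= ltnn.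
by rewrite !andbF.
Qed.

Lemma parts_stable m n : n <= m -> parts m n = parts n n.
Proof.
elim: m => [|m IHm]; first by rewrite leqn0 => /eqP ->.
rewrite leq_eqVlt => /predU1P[->//|nm]; rewrite partsS (_ : n <= m) ?orbT //.
by rewrite cats0 IHm.
Qed.

Lemma mem_parts_self n s :
  (s \in parts n n) = [&& is_partition s, regular l s & sumn s == n].
Proof.
rewrite mem_parts /part_pred; case: (is_partition s) => //=; case: (regular l s) => //=.
case: (eqVneq (sumn s) n) => [<-|_]; rewrite ?andbF ?andbT //.
by apply/allP => k /mem_le_sumn.
Qed.

Fixpoint multiparts r n : seq (r.-tuple (seq nat)) :=
  match r with
  | 0 => nseq (n == 0) [tuple]
  | r'.+1 => flatten
      [seq [seq cons_tuple s t | s <- parts i i, t <- multiparts r' (n - i)] | i <- iota 0 n.+1]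
  end.

Lemma multipartsS r n : multiparts r.+1 n = flatten
  [seq [seq cons_tuple s t | s <- parts i i, t <- multiparts r (n - i)] | i <- iota 0 n.+1].
Proof. by []. Qed.

Lemma regular_multipartitionE r n (t : r.-tuple (seq nat)) :
  regular_multipartition l n t =
  all (fun s => is_partition s && regular l s) t && (sumn (map sumn t) == n).
Proof.
rewrite /regular_multipartition sumnE big_map big_tuple; congr (_ && _).
by apply/forallP/all_tnthP.
Qed.

Lemma mem_multiparts r n t :
  (t \in multiparts r n) = regular_multipartition l n t.
Proof.
rewrite regular_multipartitionE; elim: r n t => [|r IHr] n t.
  by rewrite (tuple0 t) mem_nseq eqxx andbT /= eq_sym lt0b.
case/tupleP: t => s t; rewrite multipartsS.
set I := iota _ _; apply/flatten_mapP/idP => [[i ii]|].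
  case/allpairsP=> -[s' t'] /= [s'i t'n] /(congr1 val) /= [-> ->].
  move: s'i t'n ii; rewrite mem_parts_self IHr mem_iota => /and3P[-> -> /eqP ->].
  by move=> /andP[-> /eqP ->] /= ?; apply/eqP; lia.
move=> tP; have {tP} /= /andP[/andP[/andP[sp sr] tp] /eqP sn] := tP.
exists (sumn s); first by rewrite /I mem_iota; lia.
apply/allpairsP; exists (s, t) => /=; split; last by apply/val_inj.
  by rewrite mem_parts_self sp sr eqxx.
by rewrite IHr tp /=; apply/eqP; lia.
Qed.

Lemma uniq_multiparts r n : uniq (multiparts r n).
Proof.
elim: r n => [|r IHr] n; first by rewrite /=; case: (n == 0).
rewrite multipartsS.
apply: (@uniq_flatten_map _ _ _ (fun t : r.+1.-tuple _ => sumn (head [::] t))).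
- exact: iota_uniq.
- move=> i; apply: allpairs_uniq => [|| [s t] [s' t'] _ _ /(congr1 val) /= [-> /val_inj ->]] //.
  exact: uniq_parts.
- move=> i t /allpairsP[[s t']] /= [+ _ ->] /=.
  by rewrite mem_parts_self => /and3P[_ _ /eqP].
Qed.

Lemma B_multiparts r n : B l r n = size (multiparts r n).
Proof. by apply: B_unique_count => [|t]; [apply: uniq_multiparts | apply: mem_multiparts]. Qed.

Lemma B0 n : B l 0 n = (n == 0).
Proof. by rewrite B_multiparts size_nseq. Qed.

Lemma BS r n : B l r.+1 n = \sum_(i < n.+1) size (parts i i) * B l r (n - i).
Proof.
rewrite B_multiparts multipartsS size_flatten /shape -map_comp sumnE big_map.
rewrite -[n.+1]subn0 -/(index_iota 0 _).
rewrite big_mkord; apply: eq_bigr => i _.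
by rewrite [LHS]size_allpairs B_multiparts.
Qed.

End Partitions.

(** * The generating function as a quotient of Euler products *)

Section GeneratingFunction.
Local Open Scope ring_scope.
Variables (F : fieldType) (l K : nat).
Hypothesis l_gt0 : (0 < l)%N.

Definition gen_parts m : {poly F} := \poly_(i < K) (size (parts l m i))%:R.
Definition gen_regular : {poly F} := \poly_(i < K) (size (parts l i i))%:R.

Lemma gen_regular_coef r n : (n < K)%N -> (gen_regular ^+ r)`_n = (B l r n)%:R.
Proof.
elim: r n => [|r IHr] n nK; first by rewrite expr0 coef1 B0.
rewrite exprS coefM BS natr_sum; apply: eq_bigr => i _.
rewrite coef_poly IHr; last by lia.
by rewrite (_ : (i < K)%N) ?natrM //; have := ltn_ord i; lia.
Qed.

(** The left series is the product of the 1 / (1 - q^i) over i <= m prime to divisibility by l;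
    [qpoch F m] cancels it and leaves the factors with i = l k, k <= m / l. *)
Lemma gen_parts_qpoch m :
  eqmodX K (gen_parts m * qpoch F m) (qpoch F (m %/ l) \Po 'X^l).
Proof.
elim: m => [|m IHm].
  rewrite div0n !qpoch0 comp_polyC mulr1; apply: coef_eqmodX => i iK.
  by rewrite coef_poly iK coef1 parts0 size_nseq.
rewrite qpochS divnS //; case: (boolP (l %| m.+1)%N) => lm.
  rewrite add1n qpochS comp_polyM mulrA.
  have -> : gen_parts m.+1 = gen_parts m.
    by apply/polyP => i; rewrite !coef_poly partsS lm cats0.
  apply: eqmodXM IHm _; rewrite comp_polyB comp_polyC comp_Xn_poly -exprM mulnC.
  have -> : ((m %/ l).+1 * l = m.+1)%N.
    by have := divnS m l_gt0; rewrite lm add1n => <-; rewrite divnK.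
  exact: eqmodX_refl.
rewrite add0n mulrCA mulrC; apply: eqmodX_trans IHm; apply: eqmodXM (eqmodX_refl _ _).
apply: coef_eqmodX => i iK.
rewrite mulrBr mulr1 coefB coefMXn !coef_poly iK partsS (negPf lm) /=.
rewrite size_cat natrD; rewrite ltnS; case: (leqP i m) => im; first by rewrite !addr0 subr0.
 by rewrite size_map (_ : (i - m.+1 < K)%N) ?addrK //; lia.
Qed.

Lemma gen_regular_qpoch n : (K <= n.+1)%N ->
  eqmodX K (gen_regular * qpoch F n) (qpoch F n \Po 'X^l).
Proof.
(* The bound l n makes the quotient by l exactly n, and it is large enough for every partition of an
   i < K. *)
move=> Kn; have := gen_parts_qpoch (l * n); rewrite mulKn //; apply: eqmodX_trans.
have -> : gen_regular = gen_parts (l * n).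
  apply/polyP => i; rewrite !coef_poly; case: ifP => // iK; rewrite parts_stable //.
  by apply: leq_trans (leq_pmull _ _); lia.
apply: eqmodXM (eqmodX_refl _ _) _; apply/eqmodX_sym/(eqmodX_leq Kn)/qpoch_leq.
exact: leq_pmull.
Qed.

End GeneratingFunction.

(** * The form 3x^2 + 5y^2 *)

Lemma even_card_involution (T : finType) (A : {set T}) (f : T -> T) :
  {in A, forall x, [/\ f x \in A, f (f x) = x & f x != x]} -> ~~ odd #|A|.
Proof.
move: {2}#|A| (leqnn #|A|) => n; elim: n A => [|n IHn] A.
  by rewrite leqn0 => /eqP ->.
have [->|[a aA]] := set_0Vmem A; first by rewrite cards0.
move=> An fA; have [faA ffa fa] := fA a aA.
have E : #|A| = #|A :\ a :\ f a|.+2.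
  by rewrite (cardsD1 a) aA (cardsD1 (f a) (A :\ a)) !inE faA fa.
rewrite E /= negbK; apply: IHn => [|x]; first by rewrite E in An; lia.
rewrite !inE => /and3P[xfa xa xA]; have [fxA ffx fx] := fA x xA.
split=> //; rewrite fxA andbT; apply/andP; split.
  by apply: contraNneq xa => /(congr1 f); rewrite ffx ffa => ->.
by apply: contraNneq xfa => /(congr1 f); rewrite ffx => ->.
Qed.

(** With x^2 = 8 X + 1 and y^2 = 24 Y + 1 the equation says X + 5 Y = 4 m + 2. *)
Definition represents m x y :=
  [&& x %% 2 == 1, y %% 2 == 1, y %% 3 != 0 & 3 * x ^ 2 + 5 * y ^ 2 == 96 * m + 56].

(* Multiplication of 3x + y sqrt(-15) by the norm-one element (1 + sqrt(-15))/4
   or by its conjugate, whichever gives an integral result, up to signs. *)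
Definition flip x y :=
  if x == y %[mod 4] then (((x - 5 * y) + (5 * y - x)) %/ 4, (3 * x + y) %/ 4)
  else ((x + 5 * y) %/ 4, ((3 * x - y) + (y - 3 * x)) %/ 4).

(** An odd square is 1 or 9 modulo 16 according as its root is 1 or 3 modulo 8 up to sign, and a
    value 8 modulo 16 forces both squares to agree. This makes both coordinates of [flip] odd. *)
Lemma represents_mod8 m x y : represents m x y ->
  x %% 8 = y %% 8 \/ (x + y) %% 8 = 0.
Proof.
case/and4P=> x1 y1 _ /eqP E.
have {E} : 3 * ((x %/ 8) * 8 + x %% 8) ^ 2 + 5 * ((y %/ 8) * 8 + y %% 8) ^ 2 = 96 * m + 56.
  by rewrite -!divn_eq.
move: (x %/ 8) (y %/ 8) => a b.
have : x %% 8 \in [:: 1; 3; 5; 7] by rewrite !inE; lia.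
have : y %% 8 \in [:: 1; 3; 5; 7] by rewrite !inE; lia.
rewrite !inE => /or4P[] /eqP ey /or4P[] /eqP ex; rewrite ex ey; lia.
Qed.

Lemma flipP m x y : represents m x y ->
  [/\ represents m (flip x y).1 (flip x y).2,
      flip (flip x y).1 (flip x y).2 = (x, y) & (flip x y).1 != x].
Proof.
move=> rxy; have := represents_mod8 rxy; case/and4P: rxy => x1 y1 y3 /eqP E xy8.
(* An odd square is 1 modulo 4, whereas 12 m + 7 is 3. *)
have xx : x * x <> 12 * m + 7.
  have xE : x = 2 * (x %/ 2) + 1 by lia.
  by rewrite xE; lia.
rewrite /represents /flip; case: (eqVneq (x %% 4) (y %% 4)) => xy4;
  rewrite [fst _]/= [snd _]/=.
- set u := (x - _ + _) %/ 4; set v := (3 * x + y) %/ 4.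
  have hv : 4 * v = 3 * x + y by rewrite /v; clear -x1 y1 xy4; lia.
  have hu : 4 * u = x - 5 * y + (5 * y - x) by rewrite /u; clear -x1 y1 xy4; lia.
  have {}xy8 : x %% 8 = y %% 8 by clear -x1 y1 xy8 xy4; lia.
  move: u v hu hv => u v hu hv.
  split.
  + have uv : (x = 4 * u + 5 * y /\ v = 3 * u + 4 * y) \/ (x + 4 * u = 5 * y /\ v + 3 * u = 4 * y).
      clear -hu hv; lia.
    apply/and4P; split; [clear -x1 y1 xy8 hu hv; lia | clear -x1 y1 xy8 hu hv; lia
      | clear -y3 hv; lia | apply/eqP; rewrite -E; clear -uv].
    case: uv => -[xE vE]; first by subst x v; lia.
    (* With this sign x and v are differences, so the identity is proved over the integers. *)
    have EZ (a b c d : int) : a = (5 * b - 4 * c)%R ->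
        d = (4 * b - 3 * c)%R ->
        (3 * (c * c) + 5 * (d * d) = 3 * (a * a) + 5 * (b * b))%R.
      by move=> -> ->; ring.
    have := EZ x y u v ltac:(lia) ltac:(lia); lia.
  + clear -x1 y1 xy8 hu hv; case: eqP => uv4; congr pair; lia.
  (* Here u = x forces x = y, hence x^2 = 12 m + 7. *)
  + clear -E xx hu; apply/eqP => ux; apply: xx.
    have xy : x = y by lia.
    by subst y; lia.
- set u := (x + 5 * y) %/ 4; set v := (3 * x - y + (y - 3 * x)) %/ 4.
  have hu : 4 * u = x + 5 * y by rewrite /u; clear -x1 y1 xy4; lia.
  have hv : 4 * v = 3 * x - y + (y - 3 * x) by rewrite /v; clear -x1 y1 xy4; lia.
  have {}xy8 : (x + y) %% 8 = 0 by clear -x1 y1 xy8 xy4; lia.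
  move: u v hu hv => u v hu hv.
  split.
  + have uv : (y = 3 * x + 4 * v /\ u = 4 * x + 5 * v) \/ (y + 4 * v = 3 * x /\ u + 5 * v = 4 * x).
      clear -hu hv; lia.
    apply/and4P; split; [clear -x1 y1 xy8 hu hv; lia | clear -x1 y1 xy8 hu hv; lia
      | clear -y3 hv; lia | apply/eqP; rewrite -E; clear -uv].
    case: uv => -[yE uE]; first by subst y u; lia.
    have EZ (a b c d : int) : b = (3 * a - 4 * d)%R ->
        c = (4 * a - 5 * d)%R ->
        (3 * (c * c) + 5 * (d * d) = 3 * (a * a) + 5 * (b * b))%R.
      by move=> -> ->; ring.
    have := EZ x y u v ltac:(lia) ltac:(lia); lia.
  + clear -x1 y1 xy8 hu hv; case: eqP => uv4; congr pair; lia.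
  (* Here u = x would give 3 x = 5 y, so 3 would divide y. *)
  + clear -y3 hu x1; lia.
Qed.

(** The bounds ensure that the box contains all solutions, so [flip] does not leave it. *)
Lemma even_represents k a b : 96 * k + 56 <= a -> 96 * k + 56 <= b ->
  ~~ odd #|[set p : 'I_a.+1 * 'I_b.+1 | represents k p.1 p.2]|.
Proof.
move=> ka kb; pose f (p : 'I_a.+1 * 'I_b.+1) : 'I_a.+1 * 'I_b.+1 :=
  (inord (flip p.1 p.2).1, inord (flip p.1 p.2).2).
have bound x y : represents k x y -> x < a.+1 /\ y < b.+1.
  case/and4P=> _ _ _ /eqP E; split; nia.
apply: (@even_card_involution _ _ f) => -[x y]; rewrite inE /= => /flipP[rf ff fx].
have [bx by_] := bound _ _ rf.
rewrite inE /f /= !inordK //; split=> //; last first.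
  by apply: contra fx => /eqP[/(congr1 val)/=]; rewrite inordK // => ->.
by rewrite ff /= !inord_val.
Qed.

(** * Residues of exponents *)

Section ResidueSupport.
Local Open Scope ring_scope.
Variables (R : nzRingType) (d : nat).
Implicit Types (S : seq nat) (f g : {poly R}).

Definition residues S f := forall i, f`_i != 0 -> (i %% d)%N \in S.

Lemma residues0 S : residues S 0.
Proof. by move=> i; rewrite coef0 eqxx. Qed.

Lemma residuesD S f g : residues S f -> residues S g -> residues S (f + g).
Proof.
move=> Sf Sg i; rewrite coefD; have [->|/Sf //] := eqVneq f`_i 0.
by rewrite add0r => /Sg.
Qed.

Lemma residuesX S e : (e %% d)%N \in S -> residues S 'X^e.
Proof. by move=> Se i; rewrite coefXn; case: (i =P e) => [->|_]; rewrite ?eqxx. Qed.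

Lemma residues_sum S (I : Type) (r : seq I) (f : I -> {poly R}) :
  (forall i, residues S (f i)) -> residues S (\sum_(i <- r) f i).
Proof.
move=> Sf; apply: big_ind => [|f1 f2|i _]; [exact: residues0 | exact: residuesD|exact: Sf].
Qed.

Lemma residues_sign S j f : residues S f -> residues S ((-1) ^+ j * f).
Proof.
move=> Sf i; rewrite -signr_odd; case: (odd j); last by rewrite mul1r; apply: Sf.
by rewrite mulN1r coefN oppr_eq0; apply: Sf.
Qed.

Lemma residues_natl S j f : residues S f -> residues S (j%:R * f).
Proof.
move=> Sf i; rewrite mulr_natl coefMn; have [->|/Sf //] := eqVneq f`_i 0.
by rewrite mul0rn eqxx.
Qed.

(** The hypothesis on the sumset is boolean, so that concrete lists are settled by computation. *)
Lemma residuesM S T U f g :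
  all (fun s => all (fun t => ((s + t) %% d)%N \in U) T) S ->
  residues S f -> residues T g -> residues U (f * g).
Proof.
move=> /allP STU Sf Tg i; apply: contraR => iU; rewrite coefM big1 // => j _.
have [->|/Sf jS] := eqVneq f`_j 0; first by rewrite mul0r.
have [->|/Tg ijT] := eqVneq g`_(i - j) 0; first by rewrite mulr0.
have := STU _ jS => /allP /(_ _ ijT); rewrite modnDml modnDmr subnKC ?(negPf iU) //.
by rewrite -ltnS.
Qed.

Lemma residues_comp e g : (0 < e)%N -> (d %| e)%N -> residues [:: 0%N] (g \Po 'X^e).
Proof.
move=> e0 de i; rewrite coef_comp_poly_Xn //; case: ifP => [ei _|]; last by rewrite eqxx.
by rewrite inE; apply: dvdn_trans ei.
Qed.

Lemma residues0X f n : residues [:: 0%N] f -> residues [:: 0%N] (f ^+ n).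
Proof.
move=> f0; elim: n => [|n IHn].
  by rewrite expr0 -(expr0 'X); apply: (@residuesX _ 0); rewrite mod0n.
by rewrite exprS; apply: residuesM f0 IHn; rewrite /= mod0n.
Qed.

End ResidueSupport.

(** * The theorems of Euler and Jacobi modulo 5 and 2 *)

Section PrimeCharacteristic.
Local Open Scope ring_scope.

(** The Frobenius acts on each factor: (1 - q^i)^p = 1 - q^(i p). *)
Lemma qpoch_Frobenius (F : fieldType) p n : p \in [pchar F] ->
  qpoch F n ^+ p = qpoch F n \Po 'X^p.
Proof.
rewrite -pchar_poly => chp; elim: n => [|n IHn].
  by rewrite qpoch0 expr1n comp_polyC.
rewrite qpochS exprMn IHn comp_polyM; congr (_ * _).
rewrite -(pFrobenius_autE chp) rmorphB rmorph1 /= pFrobenius_autE.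
by rewrite comp_polyB comp_polyC comp_Xn_poly -!exprM mulnC.
Qed.

Lemma residues_shanks (F : fieldType) n : residues 5 [:: 0; 1; 2]%N (shanks F n).
Proof.
elim: n => [|n IHn].
  rewrite /shanks big_nat1 big_geq // mulr1.
  by apply: residues_sign; apply: residuesX.
have E m : (2 * 'C(m.+1, 2) = m.+1 * m)%N by rewrite -mul_bin_diag bin1.
rewrite shanksS; apply: residuesD IHn _; apply: residues_sign.
have nE := divn_eq n 5; have n5 := ltn_pmod n (isT : 0 < 5)%N.
have := E n; have := E n.+1; move: (n %/ 5)%N (n %% 5)%N nE n5 => a r nE r5 E1 E0.
apply: residuesD; apply: residuesX; rewrite !inE.
  by move: r5 nE; do 5?case: r => [|r] //; lia.
by move: r5 nE; do 5?case: r => [|r] //; lia.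
Qed.

(** Modulo 5, ['C(j.+1, 2)] is 0 or 1 except for j = 2, where the coefficient 2j + 1 vanishes. *)
Lemma residues_cube n : residues 5 [:: 0; 1]%N
  (\sum_(j < n.+1) (2 * j).+1%:R * ((-1) ^+ j * 'X^('C(j.+1, 2))) : {poly 'F_5}).
Proof.
apply: residues_sum => j; have [j2|j2] := eqVneq (j %% 5)%N 2.
  have /eqP -> : (2 * j).+1%:R == 0 :> {poly 'F_5}; last by rewrite mul0r; apply: residues0.
  rewrite -(@dvdn_pcharf _ 5); last by rewrite pchar_poly pchar_Fp.
  lia.
apply: residues_natl; apply: residues_sign; apply: residuesX.
move: (val j) j2 => {}j j2; rewrite !inE.
have E m : (2 * 'C(m.+1, 2) = m.+1 * m)%N by rewrite -mul_bin_diag bin1.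
have nE := divn_eq j 5; have n5 := ltn_pmod j (isT : 0 < 5)%N.
have := E j; move: (j %/ 5)%N (j %% 5)%N nE n5 j2 => a r nE r5.
by move: r5 nE; do 5?case: r => [|r] //; lia.
Qed.

(** With r = 20 t + s, E_1^(4r) is a power of E_1^5, a series in q^5, times E_1^f; H is an expansion
    of the latter factor. *)
Lemma B_mod5 t s e f n S (H : {poly 'F_5}) : (4 * s = 5 * e + f)%N ->
  eqmodX n.+1 (qpoch _ n ^+ f) H -> residues 5 S H ->
  all (fun x => x %% 5 \in S)%N S -> (n %% 5)%N \notin S ->
  (5 %| B 5 (20 * t + s) n)%N.
Proof.
move=> sef qH SH S5 nS; have ch5 : 5 \in [pchar 'F_5] by rewrite pchar_Fp.
set r := (20 * t + s)%N; pose q := qpoch 'F_5 n.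
have q0 : (q ^+ r)`_0 != 0.
  by rewrite -horner_coef0 horner_exp horner_coef0 qpoch_coef0 expr1n oner_neq0.
have := gen_regular_qpoch 'F_5 (isT : 0 < 5)%N (leqnn n.+1).
rewrite -qpoch_Frobenius // -/q => /(eqmodXX r); rewrite exprMn -exprM.
have -> : (5 * r = 5 * (16 * t + e) + f + r)%N by rewrite /r; lia.
rewrite exprD => /(eqmodX_cancel q0) /eqmodX_trans; rewrite exprD exprM qpoch_Frobenius //.
move=> /(_ _ (eqmodXM (eqmodX_refl _ _) qH)) /eqmodX_coef /(_ (ltnSn n)).
rewrite gen_regular_coef // => BE; rewrite (dvdn_pcharf ch5) BE.
set V := _ ^+ _; have SV : residues 5 [:: 0%N] V by apply: residues0X; apply: residues_comp.
apply: contraR nS; apply: (residuesM _ SV SH).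
by rewrite /= andbT; apply: sub_all S5 => x; rewrite add0n.
Qed.

(* Generalized pentagonal numbers are the (y^2 - 1)/24 with y prime to 6, and
   triangular numbers the (x^2 - 1)/8 with x odd; division drops the - 1. *)
Lemma shanks_char2 (F : fieldType) n : 2 \in [pchar F] ->
  shanks F n = \sum_(0 <= y < 6 * n + 2 | ((y %% 2 == 1) && (y %% 3 != 0))%N) 'X^(y ^ 2 %/ 24).
Proof.
rewrite -pchar_poly => ch2; elim: n => [|n IHn].
  rewrite /shanks muln0 !big_nat1 big_geq // !big_mkcond /= big_nat_recr //= big_nat1 /=.
  by rewrite add0r mulr1 expr0 mul1r.
have -> : (6 * n.+1 + 2 = (6 * n + 2).+4.+2)%N by lia.
rewrite shanksS IHn oppr_pchar2 // expr1n mul1r [in RHS]big_mkcond /=.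
(* Of the six new values 6 n + 2, ..., 6 n + 7 of y, only 6 n + 5 and 6 n + 7 are prime to 6. *)
do 6!rewrite big_nat_recr //=; rewrite -!big_mkcond.
rewrite ifF; last by lia.
rewrite ifF; last by lia.
rewrite ifF; last by lia.
rewrite ifT; last by lia.
rewrite ifF; last by lia.
rewrite ifT; last by lia.
rewrite !addr0 -addrA.
have E m : (2 * 'C(m.+1, 2) = m.+1 * m)%N by rewrite -mul_bin_diag bin1.
have := E n; have := E n.+1 => E1 E0.
congr (_ + ('X^_ + 'X^_)).
  have -> : ((6 * n + 2).+3 ^ 2 = 24 * (n.+1 * n.+1 + 'C(n.+1, 2)) + 1)%N by lia.
  lia.
have -> : ((6 * n + 2).+4.+1 ^ 2 = 24 * (n.+1 * n.+1 + 'C(n.+2, 2)) + 1)%N by lia.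
lia.
Qed.

(** In characteristic 2 the signs and the odd coefficients become 1; the substitution is x = 2j +
    1. *)
Lemma cube_char2 (F : fieldType) n : 2 \in [pchar F] ->
  \sum_(j < n) (2 * j).+1%:R * ((-1) ^+ j * 'X^('C(j.+1, 2)))
  = \sum_(0 <= x < 2 * n | (x %% 2 == 1)%N) 'X^(x ^ 2 %/ 8) :> {poly F}.
Proof.
rewrite -pchar_poly => ch2; elim: n => [|n IHn].
  by rewrite big_ord0 muln0 big_geq.
have -> : (2 * n.+1 = (2 * n).+2)%N by lia.
rewrite big_ord_recr IHn [in RHS]big_mkcond /= !big_nat_recr //= -!big_mkcond.
rewrite ifF; last by lia.
rewrite ifT; last by lia.
rewrite addr0 oppr_pchar2 // expr1n mul1r.
have -> : ((2 * n).+1 ^ 2 %/ 8 = 'C(n.+1, 2))%N.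
  have E : (2 * 'C(n.+1, 2) = n.+1 * n)%N by rewrite -mul_bin_diag bin1.
  by lia.
have -> : (2 * n).+1%:R = 1 :> {poly F}.
  by rewrite -addn1 natrD natrM (pcharf0 ch2) mul0r add0r.
by rewrite mul1r.
Qed.

End PrimeCharacteristic.

(** * Series without exponents congruent to 2 modulo 4 *)

Section ResidueTwo.
Local Open Scope ring_scope.
Variable R : idomainType.
Implicit Types (f g u : {poly R}).

Definition vanish2mod4 n f := forall i, (i < n)%N -> (i %% 4 = 2)%N -> f`_i = 0.

Lemma vanish2mod4M n f u :
  residues 4 [:: 0%N] u -> vanish2mod4 n f -> vanish2mod4 n (u * f).
Proof.
move=> u0 f2 i iN i2; rewrite coefM big1 // => j _.
have [->|/u0] := eqVneq u`_j 0; first by rewrite mul0r.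
rewrite inE => /eqP j4; rewrite f2 ?mulr0 //; have := ltn_ord j; lia.
Qed.

(** Strong induction on the exponent: the other terms of the convolution pair j > 0 divisible by 4
    with i - j, again 2 modulo 4. *)
Lemma vanish2mod4_cancel n f u : u`_0 = 1 ->
  residues 4 [:: 0%N] u -> vanish2mod4 n (u * f) -> vanish2mod4 n f.
Proof.
move=> u0 u4 uf; elim/ltn_ind => i IHi iN i2.
have := uf i iN i2; rewrite coefM big_ord_recl /= u0 mul1r subn0 big1 ?addr0 // => j _.
have [->|/u4] := eqVneq u`_(bump 0 j) 0; first by rewrite mul0r.
rewrite inE /bump /= => /eqP j4; have := ltn_ord j => ji.
by rewrite IHi ?mulr0 //; lia.
Qed.

End ResidueTwo.

Lemma odd_sqr x : x %% 2 == 1 -> x ^ 2 = 8 * (x ^ 2 %/ 8) + 1.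
Proof.
move=> x2; have xE := divn_eq x 4; have x4 : x %% 4 = 1 \/ x %% 4 = 3 by lia.
by move: (x %/ 4) xE => a; case: x4 => -> ->; lia.
Qed.

Lemma coprime6_sqr y : y %% 2 == 1 -> y %% 3 != 0 -> y ^ 2 = 24 * (y ^ 2 %/ 24) + 1.
Proof.
move=> y2 y3; have yE := divn_eq y 12.
have : y %% 12 \in [:: 1; 5; 7; 11] by rewrite !inE; lia.
have E a : 2 * 'C(a.+1, 2) = a.+1 * a by rewrite -mul_bin_diag bin1.
rewrite !inE; have := E (y %/ 12); move: (y %/ 12) yE => a yE aE.
by case/or4P=> /eqP y12; move: yE; rewrite y12 => ->; lia.
Qed.

(** * Congruences modulo 2 *)

Section ModTwo.
Local Open Scope ring_scope.

(** For i = 4k + 2 one has 96 k + 56 = 24 i + 8, so the bound on M puts all solutions within the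
    summation ranges. *)
Lemma vanish_qpoch n M : (24 * n + 8 <= M)%N ->
  vanish2mod4 n.+1 ((qpoch 'F_2 M \Po 'X^5) * qpoch 'F_2 M ^+ 3).
Proof.
move=> nM i i_n i2; have ch2 : 2 \in [pchar 'F_2] by rewrite pchar_Fp.
pose P := shanks 'F_2 M \Po 'X^5.
have qP : eqmodX M.+1 (qpoch 'F_2 M \Po 'X^5) P.
  have := eqmodX_comp 5 (qpoch_shanks 'F_2 M); apply: eqmodX_leq; lia.
have := eqmodXM qP (qpoch_cube 'F_2 M) => /eqmodX_coef /(_ (_ : (i < M.+1)%N)) -> //; last by lia.
rewrite /P shanks_char2 // cube_char2 // raddf_sum /= mulrC.
have -> : (2 * M.+1 = (2 * M + 1).+1)%N by lia.
have -> : (6 * M + 2 = (6 * M + 1).+1)%N by lia.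
rewrite !big_mkord big_distrlr /= pair_big /= coef_sum.
have ik : (i = 4 * (i %/ 4) + 2)%N by lia.
pose A := [set p : 'I_(2 * M + 1).+1 * 'I_(6 * M + 1).+1 | represents (i %/ 4) p.1 p.2].
transitivity (#|A|%:R : 'F_2).
  rewrite -sum1_card natr_sum big_mkcond [in RHS]big_mkcond /=; apply: eq_bigr => -[x y] _.
  rewrite inE /represents /=.
  case: (boolP (x %% 2 == 1)%N) => //= x1.
  case: (boolP (y %% 2 == 1)%N) => //= y1.
  case: (boolP (y %% 3 != 0)%N) => //= y3.
  rewrite comp_Xn_poly -exprM -exprD coefXn.
  set b := (_ == _); set c := (_ == _); have -> : b = c; last by case: c.
  have hx : ((x : nat) ^ 2 = 8 * (x ^ 2 %/ 8) + 1)%N by apply: odd_sqr.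
  have hy : ((y : nat) ^ 2 = 24 * (y ^ 2 %/ 24) + 1)%N by apply: coprime6_sqr.
  by rewrite /b /c; move: (_ ^ 2 %/ 8)%N (_ ^ 2 %/ 24)%N hx hy => X Y -> ->; lia.
apply/eqP; rewrite -(dvdn_pcharf ch2) dvdn2; apply: even_represents; lia.
Qed.

Lemma B_mod2 m n : (n %% 4 = 2)%N -> (2 %| B 5 (4 * m + 1) n)%N.
Proof.
move=> n2; have ch2 : 2 \in [pchar 'F_2] by rewrite pchar_Fp.
pose M := (24 * n + 8)%N; pose q := qpoch 'F_2 M; set r := (4 * m + 1)%N.
have nM : (n.+1 <= M.+1)%N by rewrite /M; lia.
have q4 : q ^+ 4 = q \Po 'X^4.
  rewrite (_ : 4 = 2 * 2)%N // exprM qpoch_Frobenius // -rmorphXn /= qpoch_Frobenius //.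
  by rewrite -comp_polyA comp_Xn_poly -exprM.
have := gen_regular_qpoch 'F_2 (isT : 0 < 5)%N nM; rewrite -/q => /(eqmodXX r).
(* The factor q^3 completes q^r to q^(4m + 4), a series in ['X^4]. *)
rewrite exprMn => /(fun h => eqmodXM h (eqmodX_refl _ (q ^+ 3))).
rewrite (dvdn_pcharf ch2) -(@gen_regular_coef _ _ n.+1) //.
set G := gen_regular _ _ _ ^+ r => GE; apply/eqP.
suff G2 : vanish2mod4 n.+1 G by apply: G2.
apply: (@vanish2mod4_cancel _ _ _ (q ^+ (4 * m.+1))).
- by rewrite -horner_coef0 horner_exp horner_coef0 qpoch_coef0 expr1n.
- by rewrite exprM q4; apply: residues0X; apply: residues_comp.
move=> i iN i2; have -> : q ^+ (4 * m.+1) * G = G * q ^+ r * q ^+ 3.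
  by rewrite -mulrA -exprD mulrC; congr (_ * _ ^+ _); rewrite /r; lia.
(* One factor E_5 stays with E_1^3; the remaining E_5^(4m) is a series in ['X^20]. *)
rewrite (eqmodX_coef GE iN) exprD exprM expr1 -mulrA.
apply: (vanish2mod4M _ (@vanish_qpoch n M (leqnn _)) iN i2).
apply: residues0X; rewrite -/q -rmorphXn /= q4 -comp_polyA comp_Xn_poly -exprM.
exact: residues_comp.
Qed.

End ModTwo.

Theorem theorem1p5 (n t : nat) :
  [/\ B 5 (20 * t + 1) (20 * n + 14) = 0 %[mod 10],
      (forall a : nat, a \in [:: 14; 18] ->
         B 5 (20 * t + 9) (20 * n + a) = 0 %[mod 10])
    & (forall a : nat, a \in [:: 2; 14; 18] ->
         B 5 (20 * t + 17) (20 * n + a) = 0 %[mod 10])].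
Proof.
have mod10 s a : s %% 4 = 1 -> a %% 4 = 2 -> 5 %| B 5 (20 * t + s) (20 * n + a) ->
    B 5 (20 * t + s) (20 * n + a) = 0 %[mod 10].
  move=> s1 a2 B5; have -> : 20 * t + s = 4 * (5 * t + s %/ 4) + 1 by lia.
  apply/eqP; rewrite mod0n -/(10 %| _) (@Gauss_dvd 2 5) // B_mod2; last by lia.
  by have -> : 4 * (5 * t + s %/ 4) + 1 = 20 * t + s by lia.
have euler := @qpoch_shanks 'F_5; have jacobi := @qpoch_cube 'F_5.
split=> [|a aE|a aE]; apply: mod10 => //.
(* 4 * 1 = 5 * 0 + 4, with E_1^4 = E_1 E_1^3; the exponent is 4 modulo 5. *)
- have := eqmodXM (euler (20 * n + 14)) (jacobi (20 * n + 14)); rewrite -exprS.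
  move=> /(@B_mod5 t 1 0 4 _ [:: 0; 1; 2; 3] _ erefl); apply=> //; last by rewrite !inE; lia.
  by apply: residuesM; [| exact: residues_shanks | exact: residues_cube].
- by move: aE; rewrite !inE; lia.
(* 4 * 9 = 5 * 7 + 1; the exponents are 4 and 3 modulo 5. *)
- have := euler (20 * n + a); rewrite -[qpoch _ _]expr1.
  move=> /(@B_mod5 t 9 7 1 _ [:: 0; 1; 2] _ erefl); apply=> //; last by move: aE; rewrite !inE; lia.
  exact: residues_shanks.
- by move: aE; rewrite !inE; lia.
(* 4 * 17 = 5 * 13 + 3; the exponents are 2, 4 and 3 modulo 5. *)
- have := jacobi (20 * n + a).
  move=> /(@B_mod5 t 17 13 3 _ [:: 0; 1] _ erefl); apply=> //; last by move: aE; rewrite !inE; lia.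
  exact: residues_cube.
Qed.
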